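(* Let $\mathbb{V}$ be a real topological vector space, $\mathbb{K}\subset\mathbb{V}$ a (closed, convex) topologically normal cone with non-empty interior, with induced partial order $\preceq$, and let $\mathbf{e}\in\mathrm{int}(\mathbb{K})$ with associated gauge norm $\|\cdot\|_{\mathbf{e}}$. Let $\theta^*\in\mathbb{V}$, $\nu\in(0,1)$, and let $\{\mathcal{H}_k\}_{k\ge 1}$ be operators $\mathcal{H}_k:\mathbb{V}\to\mathbb{V}$ such that for every $k\geq 1$: $\mathcal{H}_k(\theta)\preceq\mathcal{H}_k(\theta')$ whenever $\theta\preceq\theta'$, and $\|\mathcal{H}_k(\theta)-\mathcal{H}_k(\theta^* )\|_{\mathbf{e}}\le \nu\|\theta-\theta^*\|_{\mathbf{e}}$ for all $\theta\in\mathbb{V}$. Let $\{E_k\}_{k\ge1}$ be an arbitrary sequence in $\mathbb{V}$, $\theta_1\in\mathbb{V}$ arbitrary, and let $\{\lambda_k\}_{k\ge1}$ be any sequence of stepsizes in $(0,1)$ satisfying $$1-(1-\nu)\lambda_k\;\le\;\frac{\lambda_k}{\lambda_{k-1}}\qquad\text{for all }k\ge2.$$ Let $\theta_{k+1}=(1-\lambda_k)\theta_k+\lambda_k\{\mathcal{H}_k(\theta_k)+E_k\}$ for $k\ge1$. Define $W_k=\mathcal{H}_k(\theta^* )-\theta^*+E_k$, $P_1=0$ and $P_{k}=(1-\lambda_{k-1})P_{k-1}+\lambda_{k-1}W_{k-1}$ for $k\ge2$. Then for all $k=1,2,\ldots$, $$\|\theta_{k+1}-\theta^*\|_{\mathb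f{e}}\le\lambda_k\left\{\frac{\|\theta_1-\theta^*\|_{\mathbf{e}}}{\lambda_1}+\nu\sum_{\ell=1}^k\|P_\ell\|_{\mathbf{e}}\right\}+\|P_{k+1}\|_{\mathbf{e}}.$$
   Context: The cone $\mathbb{K}$ induces the partial order $\theta\preceq\theta'\iff\theta'-\theta\in\mathbb{K}$ on $\mathbb{V}$. For $\mathbf{e}\in\mathrm{int}(\mathbb{K})$, the order interval is $[-\mathbf{e},\mathbf{e}]=\{\theta\in\mathbb{V}\mid-\mathbf{e}\preceq\theta\preceq\mathbf{e}\}$ and the associated gauge (Minkowski) norm is $\|\theta\|_{\mathbf{e}}=\inf\{s>0\mid\theta/s\in[-\mathbf{e},\mathbf{e}]\}$. Topologically normal means that $\mathbb{V}$ has a base of neighbourhoods $U$ of $0$ that are full, i.e. $x\preceq z\preceq y$ with $x,y\in U$ implies $z\in U$. It is not required that $\theta^*$ be a fixed point of each $\mathcal{H}_k$. *)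

(* Defs.v *)
From mathcomp Require Import all_boot all_order all_algebra.
From mathcomp Require Import boolp classical_sets reals topology convex tvs.

Set Implicit Arguments.
Unset Strict Implicit.
Unset Printing Implicit Defensive.

Import Order.TTheory GRing.Theory Num.Theory.
Local Open Scope classical_set_scope.
Local Open Scope ring_scope.

(* Real topological vector spaces are [topologicalLmodType R]: unlike
   [tvsType R], this does not require local convexity. *)
Section Cones.
Context {R : realType} {V : topologicalLmodType R}.
Implicit Types (K U : set V) (e x y : V).

(* Pointedness is what makes the induced preorder [cone_le K] antisymmetric,
   hence a partial order. *)
Record closed_convex_cone K : Prop := ClosedConvexCone {
  cone_closed : closed K ;
  cone_convex : convex_set K ;
  cone_scale : forall (t : R) x, 0 <= t -> K x -> K (t *: x) ;
  cone_pointed : forall x, K x -> K (- x) -> x = 0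
}.

Definition cone_le K x y : Prop := K (y - x).

Definition order_interval K x y : set V :=
  [set z | cone_le K x z /\ cone_le K z y].

Definition full_set K U : Prop :=
  forall x y z, U x -> U y -> cone_le K x z -> cone_le K z y -> U z.

Definition topologically_normal K : Prop :=
  exists B : set (set V),
    [/\ B `<=` nbhs (0 : V),
        filter_from B id --> (0 : V)
      & forall U, B U -> full_set K U].

(* For [e] in the interior of [K] the set below is nonempty and bounded below
   by 0, so the real-valued [inf] is the genuine infimum. *)
Definition gauge_norm K e x : R :=
  inf [set s : R | 0 < s /\ order_interval K (- e) e (s^-1 *: x)].

End Cones.

(* Main.v *)
(* The shifted error D_k = theta_k - thetas - P_k absorbs the noise: it
   satisfies D_(k+1) = (1 - lambda_k) D_k
                       + lambda_k (H_k theta_k - H_k thetas).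
   Hence |D_(k+1)| <= (1 - (1 - nu) lambda_k) |D_k| + lambda_k nu |P_k|, and by
   the stepsize condition |D_(k+1)| / lambda_k grows by at most nu |P_k| at
   step k.  The gauge is subadditive and homogeneous because K is a convex cone,
   and finite because e is interior. *)
Require Import Defs.
From mathcomp Require Import all_boot all_order all_algebra.
From mathcomp Require Import boolp classical_sets reals topology convex tvs.
From mathcomp Require Import interval_inference.
From mathcomp Require Import lra.

Set Implicit Arguments.
Unset Strict Implicit.
Unset Printing Implicit Defensive.

Import Order.TTheory GRing.Theory Num.Theory.
Local Open Scope classical_set_scope.
Local Open Scope ring_scope.

Section GaugeNorm.
Context {R : realType} {V : topologicalLmodType R}.
Variables (K : set V) (e : V).
Hypotheses (coneK : closed_convex_cone K) (eK : interior K e).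

(** The sum is twice the midpoint, and the midpoint lies in [K] by convexity. *)
Lemma cone_add x y : K x -> K y -> K (x + y).
Proof.
move=> Kx Ky.
have h0 : 0 <= 2^-1 :> R by rewrite invr_ge0 ler0n.
have h1 : 2^-1 <= 1 :> R by lra.
pose xy := conv (Itv01 h0 h1) (x : convex_lmodType V) y.
have Kxy : K xy by rewrite -in_setE; apply: (cone_convex coneK); exact: mem_set.
have -> : x + y = 2 *: xy.
  rewrite [xy]/(_ *: _ + _ *: _) scalerDr !scalerA /= /unstable.onem.
  by rewrite [1 - _](_ : _ = 2^-1) ?divff ?scale1r ?pnatr_eq0//; lra.
exact: (cone_scale coneK).
Qed.

(** The condition that [s^-1 *: x] lies between [- e] and [e], with the denominator cleared: both
    memberships become jointly linear in [s] and [x], so members for different vectors can be added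
    and rescaled inside the cone. *)
Definition gauge_set x : set R :=
  [set s | [/\ 0 < s, K (s *: e - x) & K (s *: e + x)]].

Lemma gauge_normE x : gauge_norm K e x = inf (gauge_set x).
Proof.
congr inf; apply/seteqP; split=> s /=.
  move=> [s0 []]; rewrite /cone_le opprK => Kp Km.
  have s_neq0 : s != 0 by rewrite gt_eqF.
  by split=> //; [move: Km|move: Kp] => /(cone_scale coneK (ltW s0));
    rewrite (scalerBr, scalerDr) scalerA mulfV// scale1r 1?addrC.
move=> [s0 Km Kp]; split=> //.
have sV0 : 0 <= s^-1 by rewrite invr_ge0 ltW.
have s_neq0 : s != 0 by rewrite gt_eqF.
by split; [move: Kp|move: Km] => /(cone_scale coneK sV0);
  rewrite /cone_le (scalerBr, scalerDr) scalerA mulVf// scale1r 1?opprK 1?addrC.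
Qed.

Lemma gauge_set_lb x : lbound (gauge_set x) 0.
Proof. by move=> s [/ltW]. Qed.

Lemma gauge_set_inf x : has_lbound (gauge_set x).
Proof. by exists 0; exact: gauge_set_lb. Qed.

(** The map sending [t] to [e + t *: x] is continuous at 0 with value [e], and [K] is a
    neighbourhood of [e]. *)
Lemma interior_segment x :
  exists2 r : R, 0 < r & forall t, `|t| < r -> K (e + t *: x).
Proof.
have : e + t *: x @[t --> (0 : R^o)] --> e.
  rewrite -[X in _ --> X]addr0 -(scale0r x).
  apply: (@continuous2_cvg _ V V V _ _ _ _ +%R).
  - exact: (@add_continuous V (e, 0 *: x)).
  - exact: cvg_cst.
  - apply: (@continuous2_cvg _ R^o V V _ _ _ _ *:%R).
    + exact: (@scale_continuous R V (0, x)).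
    + exact: cvg_id.
    + exact: cvg_cst.
move=> /(_ K eK)/nbhs_ballP[r /= r0 rK]; exists r => // t tr.
by apply: rK; rewrite /ball /= sub0r normrN.
Qed.

(** Makes [inf] a genuine infimum, so that bounds valid for every member pass to it. *)
Lemma gauge_set_nonempty x : gauge_set x !=set0.
Proof.
have [r r0 rK] := interior_segment x.
(* Halving [r] meets the strict bound on [t]; dividing [e - (r / 2) *: x] and [e + (r / 2) *: x] by
   [r / 2] then gives the member [(r / 2)^-1]. *)
have r20 : 0 < r / 2 by rewrite divr_gt0.
have nr : `|r / 2| < r by rewrite gtr0_norm //; lra.
have r2_neq0 : r / 2 != 0 by rewrite gt_eqF.
have sV0 : 0 <= (r / 2)^-1 by rewrite invr_ge0 ltW.
exists (r / 2)^-1; split; first by rewrite invr_gt0.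
  have /rK : `|- (r / 2)| < r by rewrite normrN.
  move=> /(cone_scale coneK sV0).
  by rewrite scaleNr scalerBr !scalerA mulVf// scale1r.
have /(cone_scale coneK sV0) := rK _ nr.
by rewrite scalerDr !scalerA mulVf// scale1r.
Qed.

Lemma gauge_norm_ge0 x : 0 <= gauge_norm K e x.
Proof.
rewrite gauge_normE; apply: lb_le_inf; last exact: gauge_set_lb.
exact: gauge_set_nonempty.
Qed.

Lemma ler_gauge_normD x y :
  gauge_norm K e (x + y) <= gauge_norm K e x + gauge_norm K e y.
Proof.
rewrite !gauge_normE -lerBlDr; apply: lb_le_inf => [|s [s0 sm sp]].
  exact: gauge_set_nonempty.
rewrite lerBlDl -lerBlDr; apply: lb_le_inf => [|t [t0 tm tp]].
  exact: gauge_set_nonempty.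
rewrite lerBlDr; apply: ge_inf; first exact: gauge_set_inf.
split; first exact: addr_gt0.
  by rewrite [t + s]addrC scalerDl opprD addrACA; exact: cone_add.
by rewrite [t + s]addrC scalerDl addrACA; exact: cone_add.
Qed.

(** Multiplication by [a] maps [gauge_set x] into [gauge_set (a *: x)]. *)
Lemma ler_gauge_normZ a x : 0 < a ->
  gauge_norm K e (a *: x) <= a * gauge_norm K e x.
Proof.
move=> a0; rewrite !gauge_normE -ler_pdivrMl//.
apply: lb_le_inf => [|s [s0 sm sp]]; first exact: gauge_set_nonempty.
rewrite ler_pdivrMl//; apply: ge_inf; first exact: gauge_set_inf.
split; first exact: mulr_gt0.
  by rewrite -scalerA -scalerBr; exact: (cone_scale coneK (ltW a0)).
by rewrite -scalerA -scalerDr; exact: (cone_scale coneK (ltW a0)).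
Qed.

End GaugeNorm.

Lemma stepsize_recursion (R : realFieldType) (nu : R) (d p lambda : nat -> R) :
  nu < 1 -> (forall k, 0 <= d k) ->
  (forall k, (1 <= k)%N -> 0 < lambda k) ->
  (forall k, (2 <= k)%N ->
     1 - (1 - nu) * lambda k <= lambda k / lambda k.-1) ->
  (forall k, (1 <= k)%N ->
     d k.+1 <= (1 - (1 - nu) * lambda k) * d k + lambda k * nu * p k) ->
  forall k, (1 <= k)%N ->
    d k.+1 <= lambda k * (d 1%N / lambda 1%N + nu * \sum_(1 <= l < k.+1) p l).
Proof.
move=> nu1 d0 lambda0 lambda_ratio d_rec; elim=> // -[_ _|k IHk _].
  have l0 := lambda0 1%N isT; have dp := d_rec 1%N isT.
  rewrite big_nat1 mulrDr mulrCA divff ?gt_eqF// mulr1 mulrA.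
  (* The ratio condition starts at index 2; here it is enough that the factor
     [1 - (1 - nu) * lambda 1] is at most 1. *)
  have : 0 <= (1 - nu) * (lambda 1%N * d 1%N).
    by rewrite mulr_ge0 ?mulr_ge0 ?subr_ge0 ?(ltW l0) ?(ltW nu1).
  nra.
have lk0 := lambda0 k.+1 isT; have dp := d_rec k.+2 isT.
apply: le_trans dp _; rewrite big_nat_recr//= !mulrDr addrA.
rewrite [X in _ <= _ + X]mulrA lerD2r -mulrDr.
(* The factor becomes [lambda k.+2 / lambda k.+1], whose denominator cancels the leading
   [lambda k.+1] of the induction hypothesis. *)
apply: (le_trans (ler_wpM2r (d0 _) (lambda_ratio k.+2 isT))).
apply: (le_trans (ler_wpM2l _ (IHk isT))).
  by rewrite divr_ge0// ltW// lambda0.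
by rewrite mulrA divfK ?gt_eqF.
Qed.

Theorem corollary1 (R : realType) (V : topologicalLmodType R)
    (K : set V) (e : V) (thetas : V) (nu : R)
    (H : nat -> V -> V) (E theta W P : nat -> V) (lambda : nat -> R) :
  closed_convex_cone K -> topologically_normal K ->
  interior K e ->
  0 < nu -> nu < 1 ->
  (forall k, (1 <= k)%N -> forall t t' : V,
     cone_le K t t' -> cone_le K (H k t) (H k t')) ->
  (forall k, (1 <= k)%N -> forall t : V,
     gauge_norm K e (H k t - H k thetas) <= nu * gauge_norm K e (t - thetas)) ->
  (forall k, (1 <= k)%N -> 0 < lambda k /\ lambda k < 1) ->
  (forall k, (2 <= k)%N ->
     1 - (1 - nu) * lambda k <= lambda k / lambda k.-1) ->
  (forall k, (1 <= k)%N ->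
     theta k.+1 =
       (1 - lambda k) *: theta k + lambda k *: (H k (theta k) + E k)) ->
  (forall k, (1 <= k)%N -> W k = H k thetas - thetas + E k) ->
  P 1%N = 0 ->
  (forall k, (2 <= k)%N ->
     P k = (1 - lambda k.-1) *: P k.-1 + lambda k.-1 *: W k.-1) ->
  forall k, (1 <= k)%N ->
    gauge_norm K e (theta k.+1 - thetas) <=
      lambda k * (gauge_norm K e (theta 1%N - thetas) / lambda 1%N
                  + nu * \sum_(1 <= l < k.+1) gauge_norm K e (P l))
      + gauge_norm K e (P k.+1).
Proof.
move=> coneK _ eK nu0 nu1 _ contrH lambda01 lambda_ratio thetaS WE P1 PS k k1.
pose D k := theta k - thetas - P k.
have lambda0 j : (1 <= j)%N -> 0 < lambda j by move=> /lambda01[].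
have thetaE j : theta j - thetas = D j + P j by rewrite subrK.
have D1 : D 1%N = theta 1%N - thetas by rewrite /D P1 subr0.
have DS j : (1 <= j)%N ->
    D j.+1 = (1 - lambda j) *: D j + lambda j *: (H j (theta j) - H j thetas).
  move=> j1; rewrite /D thetaS// PS// WE//=.
  rewrite opprD [_ + _ - thetas]addrAC addrACA -scalerBr.
  (* The noise [E j] cancels. The leftover [thetas], weighted by [lambda j], combines with the
     subtracted [thetas] into the [- (1 - lambda j) *: thetas] that [D j] requires. *)
  have -> : H j (theta j) + E j - (H j thetas - thetas + E j) =
      H j (theta j) - H j thetas + thetas.
    by rewrite opprD addrACA subrr addr0 opprB addrCA addrC.
  rewrite scalerDr addrA addrAC; congr (_ + _).
  rewrite !scalerBr [(1 - _) *: thetas]scalerBl scale1r opprB.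
  by rewrite addrAC; congr (_ - _); rewrite addrAC addrA.
rewrite thetaE; apply: le_trans (ler_gauge_normD coneK eK _ _) _.
rewrite lerD2r -D1.
apply: (stepsize_recursion (d := fun k => gauge_norm K e (D k))) => // [j|j j1].
  exact: gauge_norm_ge0.
have [l0 l1] := lambda01 _ j1.
have l1' : 0 < 1 - lambda j by rewrite subr_gt0.
rewrite DS//; apply: le_trans (ler_gauge_normD coneK eK _ _) _.
(* Contraction is measured from [thetas], at distance [D j + P j]; this is the source of the sum of
   the norms of [P]. *)
have HD : gauge_norm K e (H j (theta j) - H j thetas) <=
    nu * (gauge_norm K e (D j) + gauge_norm K e (P j)).
  apply: le_trans (contrH j j1 (theta j)) _.
  by rewrite ler_wpM2l ?(ltW nu0)// thetaE ler_gauge_normD.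
have := ler_wpM2l (ltW l0) HD.
have := ler_gauge_normZ coneK eK (D j) l1'.
have := ler_gauge_normZ coneK eK (H j (theta j) - H j thetas) l0.
lra.
Qed.
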